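(* For all integers $n\ge 2$ and $k$ with $1\le k\le n/2$, the generalized Petersen graph $GP(n,k)$ is neighborhood-prime.
   Context: All graphs are finite and simple; $[N]=\{1,\dots,N\}$; $N(v)$ is the set of neighbors of $v$. A neighborhood-prime labeling of a graph $G$ of order $N$ is a bijection $f:V(G)\to[N]$ such that for every vertex $v$ of degree greater than $1$, $\gcd\{f(u):u\in N(v)\}=1$; a graph is neighborhood-prime if it has such a labeling. The generalized Petersen graph $GP(n,k)$ has vertex set $\{u_0,\dots,u_{n-1},v_0,\dots,v_{n-1}\}$ ($2n$ vertices) and edges $u_iu_{i+1}$, $u_iv_i$, $v_iv_{i+k}$ for each $i\in\{0,1,\dots,n-1\}$, with subscripts reduced modulo $n$ (repeated edges are counted once; in particular when $k=n/2$ each $v_i$ has neighborhood $\{u_i,v_{i+n/2}\}$). *)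

(* Defs.v *)
From mathcomp Require Import all_boot.

Set Implicit Arguments.
Unset Strict Implicit.
Unset Printing Implicit Defensive.

(* A finite simple graph is a symmetric irreflexive relation [e] (adjacency) on
   a finite type [V] of vertices. *)

Definition neighbors (V : finType) (e : rel V) (v : V) : {set V} :=
  [set u | e v u].

Definition bijection_onto_interval (V : finType) (N : nat) (f : V -> nat) :
    Prop :=
  injective f /\ (forall m : nat, (exists v, f v = m) <-> 1 <= m <= N).

Definition neighborhood_prime_labeling (V : finType) (e : rel V)
    (f : V -> nat) : Prop :=
  bijection_onto_interval #|V| f /\
  forall v : V, 1 < #|neighbors e v| ->
    \big[gcdn/0]_(u in neighbors e v) f u = 1.

Definition neighborhood_prime (V : finType) (e : rel V) : Prop :=
  exists f : V -> nat, neighborhood_prime_labeling e f.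

(* [inl i] is the vertex u_i and [inr i] the vertex v_i. *)
Definition GP_vertex (n : nat) : finType := ('I_n + 'I_n)%type.

(* [GP_edge n k x y]: {x, y} is listed, with x first, as one of the edges
   u_i u_(i+1), u_i v_i, v_i v_(i+k), subscripts modulo n. *)
Definition GP_edge (n k : nat) : rel (GP_vertex n) := fun x y =>
  match x, y with
  | inl i, inl j => nat_of_ord j == (i + 1) %% n
  | inl i, inr j => j == i
  | inr i, inr j => nat_of_ord j == (i + k) %% n
  | inr _, inl _ => false
  end.

Definition GP (n k : nat) : rel (GP_vertex n) := fun x y =>
  GP_edge k x y || GP_edge k y x.

Lemma GP_sym (n k : nat) : symmetric (@GP n k).
Proof. by move=> x y; rewrite /GP orbC. Qed.

Lemma GP_irrefl (n k : nat) :
  2 <= n -> 1 <= k -> 2 * k <= n -> irreflexive (@GP n k).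
Proof.
move=> n_ge2 k_gt0 le2kn.
have lt_kn : k < n by apply: leq_trans le2kn; rewrite mul2n -addnn -addn1 leq_add2l.
have shift (m : nat) (i : 'I_n) :
    0 < m < n -> (nat_of_ord i == (i + m) %% n) = false.
  case/andP=> m_gt0 lt_mn; rewrite -{1}(modn_small (ltn_ord i)).
  rewrite -{1}[nat_of_ord i]addn0 eqn_modDl mod0n modn_small //.
  by rewrite eq_sym; apply/negbTE; rewrite -lt0n.
by case=> i; rewrite /GP orbb /= shift ?k_gt0.
Qed.

Arguments GP : clear implicits.

(* Main.v *)
Require Import Defs.
From mathcomp Require Import all_boot.
From mathcomp Require Import zify.

(** Put the [n] pairs (v_i, u_(i+1)) in some order and give the [m]-th pair,
    counting from 0, the labels 2m+1 and 2m+2. Every u_i is then adjacent to the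
    two consecutively labelled vertices v_i and u_(i+1), so only the
    neighborhoods of the v_i constrain the order
    ([neighborhood_prime_of_order]).

    If (v_i, u_(i+1)) is the [m]-th pair, the neighbors of v_(i+1) are u_(i+1),
    labelled 2m+2, v_(i+k+1) and v_(i+1-k). When the pair of index i + k + 1
    comes immediately after that of index i, v_(i+k+1) is labelled 2m+3 and the
    gcd is 1. So list the indices by walking along the cosets of k+1 in Z/n:
    there are d = gcd(n, k+1) cosets, each a block of M = n/d consecutive
    ranks. Only the last pair of a block needs care. If the block has rank b and
    starts at the index S b, then the corresponding vertex v sees 2(b+1)M
    (the last label of the block), 2bM+1 (the first one) and the label of
    v_(S b - 2k). Two things can save it: either 2(b+1)M and 2bM+1 happen to be
    coprime, as for b = 0 and b = 1, or the index S b - 2k starts a suitable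
    block c. The next block, c = b + 1, always works because its first label is
    2(b+1)M + 1, and so does c = 0 because its first label is 1.

    Modulo d, a shift by -2k is a shift by 2. If d is odd, repeating it visits
    all cosets and comes back to block 0: one closed chain suffices. If d = 2h,
    the even cosets and the odd cosets form two closed chains of length h. The
    order used is: one even coset (block 0), all the odd cosets (blocks 1 to h),
    the remaining even cosets (blocks h+1 to 2h-1). The even chain ends next to
    the label 1; the odd one ends next to block 1, where the labels 2(h+1)M,
    2hM+1 and 2M+1 have gcd 1 ([gcdn_end_of_chain]). *)

Lemma biggcdn_dvd (I : finType) (A : {set I}) (F : I -> nat) (u : I) :
  u \in A -> \big[gcdn/0]_(i in A) F i %| F u.
Proof. by move=> Au; rewrite (bigD1 u) //= dvdn_gcdl. Qed.

(** The labels met where the chain of blocks 1, ..., h closes up: a common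
    divisor of the three divides h + 1 and h - 1, hence 2, while 2M + 1 is
    odd. *)
Lemma gcdn_end_of_chain (h M : nat) :
  gcdn (gcdn (h.+1 * M).*2 (h * M).*2.+1) (M.*2.+1) = 1.
Proof.
set g := gcdn _ _.
have g1 : g %| (h.+1 * M).*2 by rewrite !(dvdn_trans (dvdn_gcdl _ _)).
have g2 : g %| (h * M).*2.+1.
  by rewrite (dvdn_trans (dvdn_gcdl _ _)) // dvdn_gcdr.
have g3 : g %| M.*2.+1 by rewrite dvdn_gcdr.
have gh1 : g %| h.+1.
  rewrite -(dvdn_addr _ g1).
  have -> : (h.+1 * M).*2 + h.+1 = h.+1 * M.*2.+1 by nia.
  exact: dvdn_mull.
have gd : g %| 2.
  rewrite -(dvdn_addr _ (dvdn_mull h g3)).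
  have -> : h * M.*2.+1 + 2 = (h * M).*2.+1 + h.+1 by nia.
  by rewrite dvdn_addr.
have : g %| 1.
  rewrite -(dvdn_addr _ (dvdn_mull M gd)).
  by have -> : M * 2 + 1 = M.*2.+1 by lia.
by rewrite dvdn1 => /eqP.
Qed.

(** The index of rank [m] when the blocks, each a coset of [k.+1] modulo [n],
    are walked one after the other, the block of rank [b] from [S b] on. *)
Definition walk (n k : nat) (S : nat -> nat) (m : nat) : nat :=
  let M := n %/ gcdn n k.+1 in (S (m %/ M) + (m %% M) * k.+1) %% n.

(** The two ways in which the last pair of block [b] can meet its constraint.
    When 2k <= n, adding n - 2k is the shift by -2k. *)
Definition closable (n k : nat) (S : nat -> nat) (b : nat) : Prop :=
  let M := n %/ gcdn n k.+1 in
  coprime (b.+1 * M).*2 (b * M).*2.+1 \/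
  exists c, [/\ c < gcdn n k.+1, S c = S b + (n - 2 * k) %[mod n]
    & gcdn (gcdn (b.+1 * M).*2 (b * M).*2.+1) (c * M).*2.+1 = 1].

(** The residue of [walk n k S m] modulo d = gcd(n, k+1) is that of the start of
    its block, which determines the block; inside a block the position is
    determined modulo n/d, because n/d and (k+1)/d are coprime. *)
Lemma walk_inj (n k : nat) (S : nat -> nat) :
  0 < n ->
  {in gtn (gcdn n k.+1) &, injective (fun b => S b %% gcdn n k.+1)} ->
  {in gtn n &, injective (walk n k S)}.
Proof.
move=> n_gt0 Sinj m m'; rewrite !inE => lt_mn lt_m'n; rewrite /walk.
have d_gt0 : 0 < gcdn n k.+1 by rewrite gcdn_gt0 n_gt0.
have dn : gcdn n k.+1 %| n := dvdn_gcdl _ _.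
have dK : gcdn n k.+1 %| k.+1 := dvdn_gcdr _ _.
have n_def : n = n %/ gcdn n k.+1 * gcdn n k.+1 by rewrite divnK.
have K_def : k.+1 = k.+1 %/ gcdn n k.+1 * gcdn n k.+1 by rewrite divnK.
set d := gcdn n k.+1 in d_gt0 dn dK n_def K_def Sinj *.
set M := n %/ d in n_def *.
have M_gt0 : 0 < M by rewrite divn_gt0 // dvdn_leq.
have coMK : coprime M (k.+1 %/ d).
  rewrite /coprime -(eqn_pmul2r d_gt0) mul1n muln_gcdl.
  by rewrite -n_def -K_def.
have lt_b : m %/ M < d by rewrite ltn_divLR // mulnC -n_def.
have lt_b' : m' %/ M < d by rewrite ltn_divLR // mulnC -n_def.
move=> eq_w.
have eq_b : m %/ M = m' %/ M.
  apply: Sinj; rewrite ?inE //.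
  have /(congr1 (modn^~ d)) := eq_w; rewrite !modn_dvdm //.
  by rewrite K_def !mulnA !(addnC (S _)) !modnMDl.
have eq_p : m %% M = m' %% M.
  move: eq_w; rewrite eq_b => /eqP; rewrite eqn_modDl.
  wlog le_p : m m' {lt_mn lt_m'n lt_b lt_b' eq_b} / m' %% M <= m %% M.
    by move=> W; case: (leqP (m' %% M) (m %% M)) => [/W // | /ltnW/W H];
       rewrite eq_sym => /H.
  rewrite eqn_mod_dvd ?leq_mul2r ?le_p ?orbT // -mulnBl.
  rewrite [X in X %| _]n_def [k.+1]K_def mulnA dvdn_pmul2r // Gauss_dvdl //.
  move=> dv; have lt_p := ltn_pmod m M_gt0.
  case: (posnP (m %% M - m' %% M)) => [|gt0]; first lia.
  by have := dvdn_leq gt0 dv; lia.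
by rewrite (divn_eq m M) (divn_eq m' M) eq_b eq_p.
Qed.

(** The pair of rank [m] is (v_i, u_(i+1)) with [i = x m]. The hypothesis is
    about the neighborhood of v_(i+1): u_(i+1) has label 2m+2, and v_(i+1+k) and
    v_(i+1-k) belong to the pairs of ranks [m1] and [m2]. *)
Lemma neighborhood_prime_of_order (n k : nat) (x : 'I_n -> 'I_n) :
  injective x ->
  (forall m m1 m2 : 'I_n, x m1 = x m + k.+1 %[mod n] ->
     x m2 + k = x m + 1 %[mod n] ->
     gcdn (gcdn m.*2.+2 m1.*2.+1) m2.*2.+1 = 1) ->
  neighborhood_prime (GP n k).
Proof.
move=> x_inj x_gcd; have [y xK yK] := injF_bij x_inj.
pose f (w : GP_vertex n) : nat :=
  match w with
  | inl i => (y (ord_pred i)).*2.+2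
  | inr i => (y i).*2.+1
  end.
have ordSE (i : 'I_n) : nat_of_ord (ordS i) = (i + 1) %% n by rewrite /= addn1.
have f_inj : injective f.
  case=> i [] j; rewrite /f => E.
  - by congr inl; move: E => [/double_inj/val_inj/(can_inj yK)/ord_pred_inj].
  - lia.
  - lia.
  - by congr inr; move: E => [/double_inj/val_inj/(can_inj yK)].
exists f; split.
  split=> // m; split.
    rewrite card_sum card_ord => -[[i|i] <-] /=.
      by have := ltn_ord (y (ord_pred i)); lia.
    by have := ltn_ord (y i); lia.
  rewrite card_sum card_ord => /andP[m_gt0 m_le].
  have lt_q : m.-1./2 < n by lia.
  case: (boolP (odd m)) => m_odd.
    by exists (inr (x (Ordinal lt_q))); rewrite /f xK /=; lia.
  by exists (inl (ordS (x (Ordinal lt_q)))); rewrite /f ordSK xK /=; lia.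
move=> w _; set g := \big[_/_]_(_ in _) _.
have g_dvd u : GP n k w u -> g %| f u.
  by move=> wu; apply: biggcdn_dvd; rewrite inE.
case: w @g g_dvd => i g g_dvd; apply/eqP; rewrite -dvdn1.
  have dv : g %| f (inr i) by apply: g_dvd; rewrite /GP /= eqxx.
  have du : g %| f (inl (ordS i)).
    by apply: g_dvd; rewrite /GP /GP_edge ordSE eqxx.
  have := coprimenS (y i).*2.+1; rewrite /coprime => /eqP <-.
  by rewrite dvdn_gcd dv; move: du; rewrite /f ordSK.
have n_gt0 : 0 < n by apply: leq_ltn_trans (ltn_ord i).
(* The indices i + k and i - k of the other two neighbors of v_i. *)
pose i1 := Ordinal (ltn_pmod (i + k) n_gt0).
pose i2 := Ordinal (ltn_pmod (i + (n - k %% n)) n_gt0).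
have i2k : i2 + k = i %[mod n].
  have lt_k := ltn_pmod k n_gt0; rewrite /= modnDml -addnA.
  have -> : n - k %% n + k = (k %/ n).+1 * n.
    by rewrite mulSn {2}(divn_eq k n); lia.
  by rewrite addnC modnMDl.
have iE : i = (x (y (ord_pred i)) + 1) %% n :> nat.
  by rewrite yK -ordSE ord_predK.
rewrite -(x_gcd (y (ord_pred i)) (y i1) (y i2)); first last.
- by rewrite [x (y i2)]yK i2k iE modn_mod.
- by rewrite [x (y i1)]yK /= modn_mod {1}iE modnDml -addnA add1n.
rewrite !dvdn_gcd -andbA; apply/and3P; split.
- by apply: (g_dvd (inl i)); rewrite /GP /= eqxx.
- by apply: (g_dvd (inr i1)); rewrite /GP /= eqxx.
- apply: (g_dvd (inr i2)); rewrite /GP /GP_edge; apply/orP; right.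
  by rewrite i2k modn_small.
Qed.

(** Inside a block [m1] is [m.+1] and two consecutive labels give the gcd 1; at
    the end of a block [m1] is the rank at which the block starts, and
    [closable] applies. *)
Lemma neighborhood_prime_of_blocks (n k : nat) (S : nat -> nat) :
  0 < n -> 2 * k <= n ->
  {in gtn (gcdn n k.+1) &, injective (fun b => S b %% gcdn n k.+1)} ->
  (forall b, b < gcdn n k.+1 -> closable n k S b) ->
  neighborhood_prime (GP n k).
Proof.
move=> n_gt0 le_2k Sinj Scl.
have walk_lt m : walk n k S m < n by rewrite /walk ltn_pmod.
pose x (m : 'I_n) := Ordinal (walk_lt m).
have xE (m : 'I_n) : x m = walk n k S m :> nat by [].
have w_inj := walk_inj _ _ _ n_gt0 Sinj.
have x_inj : injective x.
  by move=> m m' /(congr1 val) /w_inj E; apply/val_inj/E; rewrite inE.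
have walk_mod m : walk n k S m %% n = walk n k S m by rewrite /walk modn_mod.
apply: (neighborhood_prime_of_order _ _ x x_inj) => m m1 m2.
rewrite !xE walk_mod => e1 e2.
have walk_eq m' m'' : m' < n -> m'' < n ->
    walk n k S m' = walk n k S m'' -> m' = m''.
  by move=> ? ? ?; apply: w_inj.
have d_gt0 : 0 < gcdn n k.+1 by rewrite gcdn_gt0 n_gt0.
have n_def : n = n %/ gcdn n k.+1 * gcdn n k.+1 by rewrite divnK ?dvdn_gcdl.
have K_def : k.+1 = k.+1 %/ gcdn n k.+1 * gcdn n k.+1.
  by rewrite divnK ?dvdn_gcdr.
have M_gt0 : 0 < n %/ gcdn n k.+1 by rewrite divn_gt0 // dvdn_leq ?dvdn_gcdl.
rewrite /closable in Scl; rewrite /walk in e1 e2 walk_eq.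
set d := gcdn n k.+1 in d_gt0 n_def K_def Scl Sinj e1 e2 walk_eq M_gt0.
set M := n %/ d in n_def Scl e1 e2 walk_eq M_gt0.
have MK : M * k.+1 = k.+1 %/ d * n.
  by rewrite [in LHS]K_def [in RHS]n_def mulnCA.
have lt_bd : m %/ M < d by rewrite ltn_divLR // mulnC -n_def.
have lt_p := ltn_pmod m M_gt0.
have m_def := divn_eq m M.
case: (ltnP (m %% M).+1 M) => [lt_p1|ge_p1].
  have bq : m.+1 %/ M = m %/ M.
    by rewrite {1}m_def -addnS divnMDl // (divn_small lt_p1) addn0.
  have bp : m.+1 %% M = (m %% M).+1.
    by rewrite {1}m_def -addnS modnMDl (modn_small lt_p1).
  have -> : nat_of_ord m1 = m.+1.
    apply: walk_eq => //.
      by rewrite [X in _ < X]n_def mulnC -ltn_divLR ?bq.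
    by rewrite bq bp mulSn e1 modnDml (addnC k.+1) addnA.
  have /eqP -> : coprime m.*2.+2 m.+1.*2.+1 by rewrite doubleS coprimenS.
  by rewrite gcd1n.
have p_end : (m %% M).+1 = M by apply/eqP; rewrite eqn_leq lt_p.
have m_end : m.+1 = (m %/ M).+1 * M by rewrite mulSnr {1}m_def -addnS p_end.
have start c : c < d ->
    c * M < n /\ S (c * M %/ M) + c * M %% M * k.+1 = S c %[mod n].
  move=> lt_c; split; first by rewrite [X in _ < X]n_def mulnC ltn_pmul2l.
  by rewrite mulnK // modnMl mul0n addn0.
have wm : (S (m %/ M) + m %% M * k.+1) + k.+1 = S (m %/ M) %[mod n].
  by rewrite -addnA -mulSnr p_end MK addnC modnMDl.
have -> : nat_of_ord m1 = m %/ M * M.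
  have [lt_s es] := start _ lt_bd.
  by apply: walk_eq => //; rewrite es e1 modnDml wm.
have -> : m.*2.+2 = ((m %/ M).+1 * M).*2 by rewrite -m_end.
case: (Scl _ lt_bd) => [/eqP -> | [c [lt_c eS eg]]]; first by rewrite gcd1n.
have -> // : nat_of_ord m2 = c * M.
have [lt_s es] := start _ lt_c.
apply: walk_eq => //; rewrite es eS; apply/eqP.
move: e2; rewrite !modnDml => e2.
rewrite -(eqn_modDr k) e2 -(eqn_modDr k) -addnA add1n wm.
have -> : S (m %/ M) + (n - 2 * k) + k + k = S (m %/ M) + n.
  by rewrite -!addnA addnn -mul2n subnK.
by rewrite modnDr.
Qed.

(** n - 2k = (n + 2) - 2(k + 1), and d = gcd(n, k+1) divides n and k + 1. *)
Lemma shift_mod (n k a : nat) :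
  2 * k <= n -> a * (n - 2 * k) = a.*2 %[mod gcdn n k.+1].
Proof.
move=> le_2k; set d := gcdn n k.+1.
have n0 : n = 0 %[mod d] by apply/eqP; rewrite mod0n; apply: dvdn_gcdl.
have K0 : 2 * k.+1 = 0 %[mod d].
  by apply/eqP; rewrite mod0n; apply: dvdn_mull (dvdn_gcdr _ _).
have -> : a * (n - 2 * k) = a * (n - 2 * k + 0) by rewrite addn0.
rewrite -modnMmr -modnDmr -K0 modnDmr.
have -> : n - 2 * k + 2 * k.+1 = n + 2 by rewrite mulnS addnCA subnK // addnC.
by rewrite -modnDml n0 modnDml modnMmr muln2.
Qed.

(** As d is odd, the multiples b(n - 2k), for b = 1, ..., d, meet every coset
    once. The last one, d(n - 2k), is the start of block 0, so that the chain of
    blocks 1, ..., d - 1 ends next to the label 1. *)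
Lemma neighborhood_prime_odd_blocks (n k : nat) :
  0 < n -> 2 * k <= n -> odd (gcdn n k.+1) -> neighborhood_prime (GP n k).
Proof.
move=> n_gt0 le_2k d_odd.
pose S b := (if b == 0 then gcdn n k.+1 else b) * (n - 2 * k).
apply: (neighborhood_prime_of_blocks n k S) => // [b b'|b lt_b].
  have SE c : S c = c.*2 %[mod gcdn n k.+1].
    by rewrite shift_mod //; case: eqP => // ->; rewrite -mul2n modnMl mod0n.
  rewrite !inE !SE => lt_b lt_b' /eqP.
  wlog le_b : b b' lt_b lt_b' / b' <= b.
    move=> W; case: (leqP b' b) => [|/ltnW] H; first exact: W.
    by rewrite eq_sym => /(W b' b lt_b' lt_b H).
  rewrite eqn_mod_dvd ?leq_double // -doubleB -mul2n Gauss_dvdr ?coprimen2 //.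
  case: (posnP (b - b')) => [|gt0 dv]; first lia.
  by have := dvdn_leq gt0 dv; lia.
case: (posnP b) => [-> | b_gt0]; first by left; rewrite mul0n coprimen1.
right; case: (ltnP b.+1 (gcdn n k.+1)) => [lt_b1|ge_b1].
  exists b.+1; split=> //; last by rewrite gcdnAC (eqP (coprimenS _)) gcd1n.
  by rewrite /S /= (gtn_eqF b_gt0) mulSn addnC.
have b_last : b.+1 = gcdn n k.+1 by apply/eqP; rewrite eqn_leq lt_b.
exists 0; split; [by rewrite -b_last | | by rewrite mul0n gcdn1].
by rewrite /S /= (gtn_eqF b_gt0) -b_last mulSn addnC.
Qed.

(** Two chains of length h = d/2, one in the even cosets and one, shifted by 1,
    in the odd ones. In each chain the multipliers of n - 2k run through
    h, 1, ..., h - 1, so that the last block leads back to the first one. *)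
Lemma neighborhood_prime_even_blocks (n k : nat) :
  0 < n -> 2 * k <= n -> ~~ odd (gcdn n k.+1) -> neighborhood_prime (GP n k).
Proof.
move=> n_gt0 le_2k d_even.
have d_gt0 : 0 < gcdn n k.+1 by rewrite gcdn_gt0 n_gt0.
pose h := (gcdn n k.+1)./2.
have d_def : gcdn n k.+1 = h.*2 by rewrite even_halfK.
pose a b := if b == 0 then h else if b == 1 then h else
  if b <= h then b.-1 else b - h.
pose S b := a b * (n - 2 * k) + (0 < b <= h).
have next b c : a c = (a b).+1 -> (0 < c <= h) = (0 < b <= h) ->
    S c = S b + (n - 2 * k) %[mod n].
  by rewrite /S => -> ->; rewrite mulSnr addnAC.
apply: (neighborhood_prime_of_blocks n k S) => // [b b'|b lt_b].
  have SE c : c < h.*2 -> S c %% gcdn n k.+1 =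
      if c <= h then (if c == 0 then 0 else (c.-1).*2.+1) else (c - h).*2.
    move=> lt_c; rewrite /S -modnDml shift_mod // modnDml d_def /a.
    have Z : h.*2 %% h.*2 = 0 by rewrite modnn.
    have Z1 : (h.*2 + 1) %% h.*2 = 1 by rewrite modnDl modn_small //; lia.
    case: eqP => [->|c0] /=; first by rewrite addn0.
    have -> : 0 < c by lia.
    case: eqP => [->|c1] /=.
      by have -> : 0 < h by lia.
    by case: leqP => le_c; rewrite ?addn0 modn_small; lia.
  rewrite !inE d_def => lt_b lt_b'; rewrite -d_def !SE //.
  by do 2!case: leqP => ?; do ?case: eqP => ?; lia.
rewrite /closable; set M := n %/ _.
(* The gcd condition met when block b is followed by the next block of its
   chain. *)
have chain : gcdn (gcdn (b.+1 * M).*2 (b * M).*2.+1) (b.+1 * M).*2.+1 = 1.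
  by rewrite gcdnAC (eqP (coprimenS _)) gcd1n.
rewrite d_def in lt_b *.
case: (posnP b) => [-> | b_gt0]; first by left; rewrite mul0n coprimen1.
case: (eqVneq b 1) => [-> | b_neq1].
  left; rewrite mul1n; apply/eqP; have := gcdn_end_of_chain 1 M.
  by rewrite mul1n -gcdnA gcdnn.
right; case: (eqVneq b h) => [bh | b_neqh].
  exists 1; split; first lia.
    by apply: next; rewrite /a /= ?bh ?leqnn; repeat case: eqP; lia.
  by rewrite mul1n bh gcdn_end_of_chain.
case: (eqVneq b h.*2.-1) => [bd | b_neqd].
  have b_gt : (b <= h) = false by lia.
  exists 0; split; first lia.
    apply: next; rewrite ?b_gt ?andbF //.
    by rewrite /a (gtn_eqF b_gt0) (negPf b_neq1) b_gt /=; lia.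
  by rewrite mul0n gcdn1.
exists b.+1; split=> //; first lia.
have b1_neq1 : b.+1 == 1 = false by lia.
apply: next; last by lia.
rewrite /a b1_neq1 (gtn_eqF b_gt0) (negPf b_neq1) /=.
case: (ltnP b h) => ?; first by rewrite (_ : b <= h); lia.
by rewrite (_ : b <= h = false); lia.
Qed.

Theorem theorem6 (n k : nat) (n_ge2 : 2 <= n) (k_ge1 : 1 <= k)
    (k_le_half : 2 * k <= n) :
  neighborhood_prime (GP n k).
Proof.
have n_gt0 : 0 < n := ltnW n_ge2.
case: (boolP (odd (gcdn n k.+1))).
  exact: neighborhood_prime_odd_blocks.
exact: neighborhood_prime_even_blocks.
Qed.
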